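(* Let $\mathcal G=(V,E)$ be a finite graph and $T$ a finite set of tiles on $\mathcal G$, all of the same size $\delta$. For any $\vec\alpha=(\alpha_v)_{v\in V}\in\mathcal M_{\mathbb R}$ with $\sum_{v\in V}\alpha_v=\delta$ and any weight function $w:T\to\mathbb R_{>0}$, there is a unique weight function $w':T\to\mathbb R_{>0}$ gauge equivalent to $w$ with the property that for all $v\in V$ the sum of the weights of the tiles containing the vertex $v$ (counted with multiplicity) is $\alpha_v$, that is, $$\sum_{t\in T}w'_t\,t_v=\alpha_v\qquad(v\in V).$$ A corresponding gauge transformation $f:V\to\mathbb R_{>0}$ (from $w$ to $w'$) solves the criticality equations $$\frac{x_v\,\partial P/\partial x_v}{P}=\alpha_v\qquad(v\in V)$$ with $x_v=f(v)$, where $P$ is the tiling polynomial of $(T,w)$.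
   Context: A tile $t$ on $\mathcal G$ is a multiset of vertices, with $t_v\in\mathbb Z_{\ge0}$ the multiplicity of $v\in V$ in $t$; its size is $\sum_{v}t_v$. A weight function assigns a positive real weight $w_t$ to each tile $t\in T$. The tiling polynomial is $P(x)=\sum_{t\in T}w_t\prod_{v\in V}\frac{x_v^{t_v}}{t_v!}$ in variables $x=(x_v)_{v\in V}$. Weight functions $w,w'$ on $T$ are gauge equivalent if there is a positive function $f:V\to\mathbb R_{>0}$, called a gauge transformation (from $w$ to $w'$), such that $w'_t=w_t\prod_{v\in V}f(v)^{t_v}$ for all $t\in T$. Let $D:\mathbb R^T\to\mathbb R^V$ be the linear map defined by $D(e_t)=\sum_{v\in V}t_ve_v$, where $e_t$ and $e_v$ denote standard basis vectors; the real cone of feasible multiplicities is $\mathcal M_{\mathbb R}=D((\mathbb R_{>0})^T)$.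
   Formalization: The criticality equations as printed fail for some tiles with multiplicities; they are proved for P without the factorials (P=Σ w_t x^t) for every T, and for the printed P only when ∏_v t_v! is the same for all tiles in T (e.g. multiplicity-free tiles). *)

(* Defs.v *)
From HB Require Import structures.
From mathcomp Require Import all_boot all_order all_algebra.
From mathcomp Require Import finmap multiset.
From mathcomp Require Import all_classical all_reals all_analysis.

Set Implicit Arguments.
Unset Strict Implicit.
Unset Printing Implicit Defensive.

Import Order.TTheory GRing.Theory Num.Theory.
Import numFieldNormedType.Exports.

Local Open Scope fset_scope.
Local Open Scope mset_scope.
Local Open Scope classical_set_scope.
Local Open Scope ring_scope.

(* A finite set of tiles is a [T : {fset {mset V}}], coerced to the finite type
   of its elements; [val t v] is the multiplicity of [v] in [t : T].  The edges
   of the graph play no role in these notions. *)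
Section Tilings.
Context {R : realType} {V : finType}.

Definition tile_size (t : {mset V}) : nat := (\sum_(v : V) t v)%N.

(* A gauge transformation f from w to w' with \sum_t w'_t t_v = alpha_v solves
   the criticality equations of \sum_t w_t x^t, which is the tiling polynomial
   of the weights (\prod_v t_v!) w_t.  For the tiling polynomial of w itself
   the equations can fail when \prod_v t_v! is not constant on T: for
   V = {a, b}, T = {aa, ab, bb}, w = 1 they force f(a) f(b) = 0 unless
   alpha_a = alpha_b.  They hold when it is constant on T, in particular when
   every t_v is at most 1. *)
Definition tile_fact (t : {mset V}) : nat := (\prod_(v : V) (t v)`!)%N.

Context {T : {fset {mset V}}}.
Implicit Types (w : T -> R) (x f alpha : V -> R).

Definition weight_function w : Prop := forall t : T, 0 < w t.

Definition tiling_polynomial w x : R :=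
  \sum_(t : T) w t * \prod_(v : V) (x v ^+ val t v / ((val t v)`!)%:R).

Definition gauge_transformation f w w' : Prop :=
  (forall v : V, 0 < f v) /\
  (forall t : T, w' t = w t * \prod_(v : V) f v ^+ val t v).

Definition gauge_equivalent w w' : Prop :=
  exists f, gauge_transformation f w w'.

(* The linear extension of e_t |-> \sum_v t_v e_v. *)
Definition multiplicity_map w : V -> R :=
  fun v => \sum_(t : T) w t * (val t v)%:R.

Definition feasible_cone : set (V -> R) :=
  multiplicity_map @` [set m | forall t : T, 0 < m t].

End Tilings.

Arguments feasible_cone {R V} T.

Definition partial {R : realType} {V : finType}
    (v : V) (F : (V -> R) -> R) (x : V -> R) : R :=
  derive1 (fun s : R => F [eta x with v |-> s]) (x v).

Definition solves_criticality {R : realType} {V : finType}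
    (P : (V -> R) -> R) (alpha x : V -> R) : Prop :=
  forall v : V, x v * partial v P x / P x = alpha v.

(* Main.v *)
(* Write alpha = D m with m > 0.  On the row space U of the matrix (t_v), the
   convex function F(u) = \sum_t (w_t exp u_t - m_t u_t) is coercive because
   every m_t is positive, so it attains a minimum at some u_t = \sum_v y_v t_v.
   Its critical point equations say that w'_t = w_t exp u_t has multiplicities
   alpha, so f = exp y is the gauge transformation.  If w' and w'' are two
   solutions, ln w' - ln w'' lies in U while w' - w'' is orthogonal to U, hence
   \sum_t (w'_t - w''_t) (ln w'_t - ln w''_t) = 0, and w' = w'' since ln is
   increasing.  Summing the multiplicities over v gives delta \sum_t w'_t =
   delta, which normalizes P in the criticality equations. *)
Require Import Defs.
From mathcomp Require Import all_boot all_order all_algebra.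
From mathcomp Require Import finmap multiset.
From mathcomp Require Import all_classical all_reals all_analysis.
From mathcomp Require Import ring lra.

Set Implicit Arguments.
Unset Strict Implicit.
Unset Printing Implicit Defensive.

Import Order.TTheory GRing.Theory Num.Theory.
Import numFieldNormedType.Exports.

Local Open Scope fset_scope.
Local Open Scope mset_scope.
Local Open Scope classical_set_scope.
Local Open Scope ring_scope.

Lemma is_derive1_sum (R : realType) (I : finType) (F : I -> R -> R)
    (dF : I -> R) (x : R) :
  (forall i, is_derive x 1 (F i) (dF i)) ->
  is_derive x 1 (fun s => \sum_i F i s) (\sum_i dF i).
Proof.
move=> dFx; rewrite -fct_sumE.
by elim/big_ind2 : _ => // [|*]; [exact: is_derive_cst|exact: is_deriveD].
Qed.

(** * Exponential sums with prescribed moments, by minimizing a convex function *)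

Section ExponentialSums.
Variable R : realType.

(* [expR x >= 1 + x] at [x = u - ln (2 * b / a)] bounds [a * expR u] below by a
   line of slope [2 * b]. *)
Lemma expR_sub_linear_ge (a b u : R) : 0 < a -> 0 < b ->
  b * `|u| - `|2 * b * (1 - ln (2 * b / a))| <= a * expR u - b * u.
Proof.
move=> a0 b0; set c := 2 * b * _.
have c_ge : - `|c| <= c by rewrite lerNl -normrN ler_norm.
have exp_ge : 2 * b * u + c <= a * expR u.
  have k0 : 0 < 2 * b / a by rewrite divr_gt0 ?mulr_gt0.
  have -> : expR u = 2 * b / a * expR (u - ln (2 * b / a)).
    by rewrite expRB lnK ?posrE// mulrCA divff ?mulr1// gt_eqF.
  rewrite mulrA mulrCA divff ?gt_eqF// mulr1 /c -mulrDr.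
  rewrite ler_pM2l ?mulr_gt0//; apply: le_trans (expR_ge1Dx _).
  by rewrite addrC addrAC addrA.
clearbody c; have [u0|/ltW u0] := leP 0 u; first by rewrite (ger0_norm u0); lra.
have := mulr_ge0 (ltW a0) (expR_ge0 u); have := normr_ge0 c.
by rewrite (ler0_norm u0); lra.
Qed.

Lemma is_derive_exp_sub_linear (a b c d x : R) :
  is_derive x 1 (fun s : R => a * expR (c + s * d) - b * (c + s * d))
    ((a * expR (c + x * d) - b) * d).
Proof.
pose l s := c + s * d.
have dl : is_derive x 1 l d.
  have -> : l = cst c + d \*: id.
    by apply/funext => s; rewrite /l /= fctE /= [d *: s]mulrC.
  by apply: is_derive_eq; rewrite add0r [_ *: _]mulr1.
have -> : (fun s => a * expR (c + s * d) - b * (c + s * d)) =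
   a \*: (expR \o l) - b \*: l by [].
by apply: is_derive_eq; rewrite /GRing.scale/=; ring.
Qed.

(** The subspace is given as the kernel of [C], hence is closed and contains 0. Coercivity puts the
    sublevel set of [F 0] inside a box, where compactness yields a minimizer. *)
Lemma exp_sub_linear_argmin (m : nat) (k : nat) (C : 'M[R]_(m, k))
    (a b : 'I_m -> R) : (forall j, 0 < a j) -> (forall j, 0 < b j) ->
  let F (u : 'rV[R]_m) := \sum_j (a j * expR (u 0 j) - b j * u 0 j) in
  exists2 u0, u0 *m C = 0 & forall u, u *m C = 0 -> F u0 <= F u.
Proof.
move=> a0 b0 F.
pose c j := `|2 * b j * (1 - ln (2 * b j / a j))|.
(* Summing the linear lower bounds gives [\sum_i b i * |u_i| <= K] as soon as [F u <= F 0], so each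
   [|u_j|] is at most [K / b j]. The sum [B] bounds all coordinates at once; the absolute value of
   [F 0] makes [K] nonnegative. *)
pose K := `|F 0| + \sum_j c j.
pose B := \sum_j K / b j.
have c_ge0 j : 0 <= c j by exact: normr_ge0.
have K_ge0 : 0 <= K by rewrite addr_ge0// sumr_ge0.
have F_coercive u : F u <= F 0 -> forall j, `|u 0 j| <= B.
  move=> Fu j; apply: (@le_trans _ _ (K / b j)); last first.
    rewrite /B (bigD1 j)//= lerDl sumr_ge0// => i _.
    by rewrite divr_ge0// ltW.
  rewrite ler_pdivlMr// mulrC.
  have : \sum_i b i * `|u 0 i| - \sum_i c i <= F u.
    by rewrite -sumrB ler_sum// => i _; exact: expR_sub_linear_ge.
  rewrite lerBlDr => /le_trans /(_ (lerD (le_trans Fu (ler_norm _)) (lexx _))).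
  apply: le_trans; rewrite (bigD1 j)//= lerDl sumr_ge0// => i _.
  by rewrite mulr_ge0// ltW.
have F_cont : continuous F.
  apply: continuous_big => [|j _ u]; first exact: add_continuous.
  have uj : {for u, continuous (fun u : 'rV[R]_m => u 0 j)}.
    exact: coord_continuous.
  have expuj : {for u, continuous (fun u : 'rV[R]_m => expR (u 0 j))}.
    by apply: continuous_comp; [exact: uj|exact: continuous_expR].
  exact: (cvgB (cvgM (cvg_cst (a j)) expuj) (cvgM (cvg_cst (b j)) uj)).
pose S := [set u : 'rV[R]_m | forall j, u 0 j \in `[- B, B]] `&`
  [set u | u *m C = 0].
have S_compact : compact S.
  apply: compact_closedI.
    apply: (@rV_compact _ _ (fun=> `[- B, B]%classic)) => _.
    exact: segment_compact.
  have -> : [set u | u *m C = 0] =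
      \bigcap_(l in [set: 'I_k])
        (fun u : 'rV[R]_m => (u *m C) 0 l) @^-1` [set x | x = 0].
    apply/seteqP; split => [u /= uC l _ /=|u uC]; first by rewrite uC mxE.
    by apply/rowP => l; rewrite [RHS]mxE; exact: uC.
  apply: closed_bigI => l _; apply: preimage_closed; last exact: closed_eq.
  move=> u _; under eq_fun do rewrite mxE.
  apply: continuous_big => [|j _ v]; first exact: add_continuous.
  exact: (cvgM (@coord_continuous R 1 m 0 j v) (cvg_cst (C j l))).
have S0 : S 0.
  split => /= [j|]; last by rewrite mul0mx.
  by rewrite mxE in_itv/= oppr_le0 andbb sumr_ge0// => i _; rewrite divr_ge0// ltW.
have [u0 /set_mem [_ u0C] u0min] := EVT_min_rV (ex_intro _ _ S0) S_compact
  (continuous_subspaceT F_cont).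
(* Points of the sublevel set lie in the box; any other point is beaten by 0, which lies in [S]. *)
exists u0 => // u uC; have [Fu|/ltW Fu] := leP (F u) (F 0).
  apply: u0min; rewrite inE; split => // j.
  by rewrite /= in_itv/= -ler_norml F_coercive.
by apply: le_trans Fu; apply: u0min; rewrite inE.
Qed.

(** The kernel of [cokermx A] is the row space of [A], so the minimizer has the form [y *m A].
    Equation [i] says that the derivative there along row [i] of [A] vanishes. *)
Lemma exp_moment_mx (n m : nat) (A : 'M[R]_(n, m)) (a b : 'I_m -> R) :
  (forall j, 0 < a j) -> (forall j, 0 < b j) ->
  exists y : 'rV[R]_n, forall i,
    \sum_j a j * expR ((y *m A) 0 j) * A i j = \sum_j b j * A i j.
Proof.
move=> a0 b0.
have [u /eqP] := exp_sub_linear_argmin (cokermx A) a0 b0.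
rewrite -submxE => /submxP[y ->{u}] umin.
exists y => i; apply/eqP; rewrite -subr_eq0 -sumrB; apply/eqP.
(* The restriction of the minimized function to the line through [y *m A] directed by row [i];
   moving by [s] adds [s] to the [i]-th entry of [y], so the line stays in the row space. *)
pose h s : R := \sum_j (a j * expR ((y *m A) 0 j + s * A i j) -
  b j * ((y *m A) 0 j + s * A i j)).
have dh (x : R) : is_derive x 1 h
    (\sum_j (a j * expR ((y *m A) 0 j + x * A i j) - b j) * A i j).
  by apply: is_derive1_sum => j; exact: is_derive_exp_sub_linear.
have h0 s : h 0 <= h s.
  have hE r : h r = \sum_j (a j * expR (((y + r *: delta_mx 0 i) *m A) 0 j) -
      b j * ((y + r *: delta_mx 0 i) *m A) 0 j).
    by apply: eq_bigr => j _; rewrite mulmxDl -scalemxAl -rowE !mxE.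
  by rewrite !hE scale0r addr0 umin//; apply/eqP; rewrite -submxE submxMl.
have dh0 : is_derive (0 : R) 1 h 0.
  apply: (@derive1_at_min _ h (- 1) 1) => [|t _||t _].
  - by lra.
  - by have [] := dh t.
  - by rewrite in_itv/= ltrN10 ltr01.
  - exact: h0.
have := @derive_val _ _ _ _ _ _ _ dh0.
rewrite (@derive_val _ _ _ _ _ _ _ (dh 0)) => dh_sum; rewrite -[RHS]dh_sum.
by apply: eq_bigr => j _; rewrite mul0r addr0 mulrBl.
Qed.
End ExponentialSums.

Lemma exp_moment (R : realType) (I J : finType) (A : I -> J -> R)
    (a b : J -> R) : (forall j, 0 < a j) -> (forall j, 0 < b j) ->
  exists y : I -> R, forall i,
    \sum_j a j * expR (\sum_k y k * A k j) * A i j = \sum_j b j * A i j.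
Proof.
move=> a0 b0.
have [y yP] := exp_moment_mx (\matrix_(i < #|I|, j < #|J|)
  A (enum_val i) (enum_val j)) (fun j => a0 (enum_val j))
  (fun j => b0 (enum_val j)).
exists (fun i => y 0 (enum_rank i)) => i; have := yP (enum_rank i).
rewrite (reindex _ (onW_bij _ (enum_val_bij J))).
rewrite [X in _ -> _ = X](reindex _ (onW_bij _ (enum_val_bij J))) /=.
congr (_ = _); apply: eq_bigr => j _; rewrite !mxE enum_rankK//.
congr (_ * expR _ * _).
rewrite [RHS](reindex _ (onW_bij _ (enum_val_bij I))) /=.
by apply: eq_bigr => k _; rewrite mxE enum_valK.
Qed.

(** * Gauge transformations in logarithmic form: uniqueness and existence *)

Lemma prod_expR_exprn (R : realType) (I : finType) (y : I -> R) (e : I -> nat) :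
  \prod_i expR (y i) ^+ e i = expR (\sum_i y i * (e i)%:R).
Proof.
by rewrite expR_sum; apply: eq_bigr => i _; rewrite mulrC expRM_natl.
Qed.

Lemma subr_mul_subr_ln_gt0 (R : realType) (x y : R) :
  0 < x -> 0 < y -> x != y -> 0 < (x - y) * (ln x - ln y).
Proof.
move=> x0 y0; rewrite neq_lt => /orP[] xy.
  by rewrite nmulr_rgt0 subr_lt0// ltr_ln.
by rewrite mulr_gt0// subr_gt0// ltr_ln.
Qed.

Lemma tile_fact_gt0 (V : finType) (t : {mset V}) : (0 < tile_fact t)%N.
Proof. by rewrite prodn_gt0// => v; exact: fact_gt0. Qed.

Section Gauge.
Variables (R : realType) (V : finType) (T : {fset {mset V}}).
Implicit Types (w : T -> R) (f : V -> R).

Lemma gauge_transformation_gt0 f w w' :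
  weight_function w -> gauge_transformation f w w' -> weight_function w'.
Proof.
move=> w0 [f0 w'E] t; rewrite w'E mulr_gt0// prodr_gt0// => v _.
exact: exprn_gt0.
Qed.

Lemma ln_gauge_transformation f w w' (t : T) :
  weight_function w -> gauge_transformation f w w' ->
  ln (w' t) = ln (w t) + \sum_v ln (f v) * (val t v)%:R.
Proof.
move=> w0 [f0 w'E].
have -> : w' t = w t * expR (\sum_v ln (f v) * (val t v)%:R).
  rewrite w'E -prod_expR_exprn; congr (_ * _); apply: eq_bigr => v _.
  by rewrite lnK// posrE.
by rewrite lnM ?posrE ?expR_gt0// expRK.
Qed.

Lemma gauge_multiplicity_map_inj w w1 w2 :
  weight_function w -> gauge_equivalent w w1 -> gauge_equivalent w w2 ->
  (forall v, multiplicity_map w1 v = multiplicity_map w2 v) -> w1 = w2.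
Proof.
move=> w0 [f1 g1] [f2 g2] eq12.
have w1_gt0 := gauge_transformation_gt0 w0 g1.
have w2_gt0 := gauge_transformation_gt0 w0 g2.
pose D t := (w1 t - w2 t) * (ln (w1 t) - ln (w2 t)).
have D_sum0 : \sum_t D t = 0.
  (* The common term [ln (w t)] cancels, leaving a combination of multiplicities; exchanging the
     sums then pairs it with the difference of the two multiplicity maps, which is zero. *)
  have DE t : D t = \sum_v (ln (f1 v) - ln (f2 v)) *
      (w1 t * (val t v)%:R - w2 t * (val t v)%:R).
    rewrite /D (ln_gauge_transformation _ w0 g1).
    rewrite (ln_gauge_transformation _ w0 g2) opprD addrACA subrr add0r -sumrB.
    by rewrite mulr_sumr; apply: eq_bigr => v _; ring.
  rewrite (eq_bigr _ (fun t _ => DE t)) exchange_big big1//= => v _.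
  rewrite -mulr_sumr sumrB; have := eq12 v; rewrite /multiplicity_map => ->.
  by rewrite subrr mulr0.
have D_ge0 t : 0 <= D t.
  have [e|ne] := eqVneq (w1 t) (w2 t); first by rewrite /D e subrr mul0r.
  exact/ltW/subr_mul_subr_ln_gt0.
apply/funext => t; apply/eqP; apply: contraT => ne.
have /(_ t isT) := psumr_eq0P (fun t _ => D_ge0 t) D_sum0.
by move=> Dt0; have := subr_mul_subr_ln_gt0 (w1_gt0 t) (w2_gt0 t) ne;
  rewrite -/(D t) Dt0 ltxx.
Qed.

(** A positive preimage [m] of [alpha] serves as the coefficients [b] of [exp_moment], and [w] as
    the coefficients [a]. *)
Lemma exists_gauge_of_feasible w alpha :
  weight_function w -> feasible_cone T alpha ->
  exists2 w', gauge_equivalent w w' & forall v, multiplicity_map w' v = alpha v.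
Proof.
move=> w0 [m m0 <-].
have [y yP] := exp_moment (fun (v : V) (t : T) => (val t v)%:R) w0 m0.
exists (fun t => w t * \prod_v expR (y v) ^+ val t v).
  by exists (expR \o y); split => // v; exact: expR_gt0.
move=> v; rewrite -[RHS]yP; apply: eq_bigr => t _.
by rewrite prod_expR_exprn.
Qed.

(** * Total weight, partial derivatives and the criticality equations *)

Lemma sum_multiplicity_map (delta : nat) w :
  (forall t, t \in T -> tile_size t = delta) ->
  \sum_v multiplicity_map w v = \sum_t w t * delta%:R.
Proof.
move=> T_size; rewrite exchange_big; apply: eq_bigr => t _ /=.
by rewrite -mulr_sumr -natr_sum -(T_size _ (valP t)).
Qed.

(** Each summand is a monomial in the variable at [v]. For a tile avoiding [v] the truncated
    exponent [0.-1 = 0] is harmless, since the factor [(val t v)%:R] is zero. *)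
Lemma partial_tiling_polynomial w f v :
  partial v (tiling_polynomial w) f =
  \sum_t w t * ((val t v)%:R * f v ^+ (val t v).-1 / (val t v)`!%:R) *
    \prod_(u | u != v) (f u ^+ val t u / (val t u)`!%:R).
Proof.
rewrite /partial derive1E.
have PE : (fun s => tiling_polynomial w [eta f with v |-> s]) =
    fun s => \sum_(t : T) (w t / (val t v)`!%:R *
      \prod_(u | u != v) (f u ^+ val t u / (val t u)`!%:R)) * s ^+ val t v.
  apply/funext => s; apply: eq_bigr => t _; rewrite (bigD1 v)//= eqxx.
  under eq_bigr => u /negPf uv do rewrite uv.
  by rewrite -!mulrA; congr (_ * _); rewrite mulrC -mulrA.
rewrite PE; apply: (@derive_val _ _ _ _ _ _ _ _).
apply: is_derive1_sum => t.
set K := _ * \prod_(_ | _) _.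
have -> : (fun s => K * s ^+ val t v) = K \*: (id ^+ val t v).
  by apply/funext => s; rewrite [in RHS]/= exprfctE.
apply: is_derive_eq; rewrite /GRing.scale/= mulr1 {}/K.
move: (\prod_(_ | _) _) => p; move: (_`!%:R^-1) => q.
move: (_%:R) (_ ^+ _) => x y; ring.
Qed.

Lemma tiling_polynomialE w f :
  tiling_polynomial w f =
  \sum_t w t / (tile_fact (val t))%:R * \prod_v f v ^+ val t v.
Proof.
apply: eq_bigr => t _.
by rewrite prodf_div /tile_fact natr_prod mulrA mulrAC.
Qed.

(** The Euler operator at [v] multiplies each monomial by its exponent at [v]. *)
Lemma mul_partial_tiling_polynomial w f v :
  f v * partial v (tiling_polynomial w) f =
  \sum_t w t / (tile_fact (val t))%:R * (\prod_u f u ^+ val t u) *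
    (val t v)%:R.
Proof.
rewrite partial_tiling_polynomial mulr_sumr; apply: eq_bigr => t _.
rewrite -[w t / _ * _]mulrA -[(_%:R)^-1 * _]mulrC.
have -> : \prod_u f u ^+ val t u / (tile_fact (val t))%:R =
    \prod_u (f u ^+ val t u / (val t u)`!%:R).
  by rewrite prodf_div /tile_fact natr_prod.
rewrite [in RHS](bigD1 v)//=.
move: (\prod_(_ | _) _) => p; move: (_`!%:R^-1) => q.
case: (val t v) => [|k]; first by rewrite mulr0 !mul0r mulr0 mul0r mulr0.
by rewrite exprS /=; move: (_%:R) (_ ^+ _) => x y; ring.
Qed.

(** The hypothesis on [u] covers both weights corrected by [tile_fact], with [c = 1], and
    uncorrected weights when [tile_fact] is constant on [T]. The factor [c] cancels in the
    quotient. *)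
Lemma gauge_solves_criticality (delta : nat) (alpha : V -> R) (c : R) u w w' f :
  (forall t, t \in T -> tile_size t = delta) ->
  \sum_v alpha v = delta%:R ->
  c != 0 -> (forall t, u t / (tile_fact (val t))%:R = c * w t) ->
  gauge_transformation f w w' ->
  (forall v, multiplicity_map w' v = alpha v) ->
  solves_criticality (tiling_polynomial u) alpha f.
Proof.
move=> T_size alpha_sum c0 uE [_ w'E] w'_alpha v.
have -> : f v * partial v (tiling_polynomial u) f = c * alpha v.
  rewrite mul_partial_tiling_polynomial -w'_alpha mulr_sumr.
  by apply: eq_bigr => t _; rewrite uE w'E !mulrA.
have -> : tiling_polynomial u f = c * \sum_t w' t.
  rewrite tiling_polynomialE mulr_sumr.
  by apply: eq_bigr => t _; rewrite uE w'E mulrA.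
(* For [delta = 0] the total weight is not determined, but all multiplicities vanish, so both sides
   are 0; this includes the empty [T], where the quotient is [0 / 0 = 0]. *)
have [delta0|delta_neq0] := eqVneq delta 0%N.
  have -> : alpha v = 0; last by rewrite mulr0 mul0r.
  rewrite -w'_alpha; apply: big1 => t _.
  have /eqP := T_size _ (valP t); rewrite delta0 sum_nat_eq0.
  by move=> /forallP/(_ v)/eqP ->; rewrite mulr0.
(* Counting multiplicities over all vertices gives [delta] times the total weight, which must equal
   [delta]. *)
have -> : \sum_t w' t = 1.
  apply: (@mulIf _ delta%:R); first by rewrite pnatr_eq0.
  rewrite mul1r -[RHS]alpha_sum mulr_suml -(sum_multiplicity_map _ T_size).
  exact: eq_bigr.
by rewrite mulr1 mulrAC divff// mul1r.
Qed.
End Gauge.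

Theorem theorem3p1 (R : realType) (V : finType)
    (E : rel V) (E_sym : symmetric E)
    (T : {fset {mset V}}) (delta : nat)
    (T_size : forall t : {mset V}, t \in T -> tile_size t = delta)
    (alpha : V -> R) (alpha_feasible : feasible_cone T alpha)
    (alpha_sum : \sum_(v : V) alpha v = delta%:R)
    (w : T -> R) (w_weight : weight_function w) :
  (exists! w' : T -> R,
      [/\ weight_function w', gauge_equivalent w w' &
          forall v : V, \sum_(t : T) w' t * (val t v)%:R = alpha v]) /\
  (forall (w' : T -> R) (f : V -> R),
      gauge_transformation f w w' ->
      (forall v : V, \sum_(t : T) w' t * (val t v)%:R = alpha v) ->
      solves_criticality
        (tiling_polynomial (fun t : T => (tile_fact (val t))%:R * w t))
        alpha f /\
      ((forall s t : {mset V}, s \in T -> t \in T ->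
          tile_fact s = tile_fact t) ->
       solves_criticality (tiling_polynomial w) alpha f)).
Proof.
split.
  have [w' gw w'_alpha] := exists_gauge_of_feasible w_weight alpha_feasible.
  exists w'; split.
    split => //; case: gw => f.
    exact: gauge_transformation_gt0.
  move=> w2 [_ gw2 w2_alpha]; apply: gauge_multiplicity_map_inj gw gw2 _ => //.
  by move=> v; rewrite w'_alpha -w2_alpha.
move=> w' f gf w'_alpha; split.
  apply: gauge_solves_criticality T_size alpha_sum (oner_neq0 R) _ gf w'_alpha.
  by move=> t; rewrite mul1r mulrAC divff ?mul1r// pnatr_eq0 -lt0n tile_fact_gt0.
move=> T_fact.
have [c c0 cE] : exists2 c : R, c != 0 &
    forall t : T, w t / (tile_fact (val t))%:R = c * w t.
  (* The constant is the inverse of the common value of [tile_fact], read off any tile [t0]; for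
     empty [T] any nonzero constant works. *)
  have [t0 _|T0] := pickP (fun _ : T => true).
    exists (tile_fact (val t0))%:R^-1.
      by rewrite invr_eq0 pnatr_eq0 -lt0n tile_fact_gt0.
    by move=> t; rewrite mulrC (T_fact _ _ (valP t) (valP t0)).
  by exists 1 => [|t]; [exact: oner_neq0|have := T0 t].
exact: gauge_solves_criticality T_size alpha_sum c0 cE gf w'_alpha.
Qed.
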